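(* For every constant $d>0$ there exist constants $c>0$, $C>0$, $N_0$ such that for every integer $N\ge N_0$ there is a (deterministic) schedule $\mathcal S$ such that algorithm $\mathrm{SPoRDAck}(N;c,\mathcal S)$, in the setting with acknowledgments, has the following property: for every integer $k$ with $1<k\le N$ and $\ln\ln N\le d\ln k$, under contention at most $k$ (i.e. for every set of at most $k$ activated stations and every wake-up pattern of these stations), any activated station $v$ transmits successfully within $C\,k^2\log N/\ln k$ rounds from its activation.
   Context: Model. There are $N$ stations with distinct IDs from a set $[N]$ of size $N$, attached to a shared channel; time is divided into synchronous rounds. Each activated station is woken up in an arbitrary round; the set of activated stations and their activation times (the wake-up pattern) are chosen by a worst-case adversary. There is no global clock: a station activated in round $\tau$ has local round $r\ge1$ in global round $\tau+r-1$. A station transmits successfully in a round if it is the only station transmitting in that round. In the setting with acknowledgments, a station that transmits successfully immediately switches off (never transmits again). Algorithm $\mathrm{SPoRDAck}(N;c,\mathcal S)$ (non-adaptive; $k$ is not known). Let $T=\lceil \ln N\rceil$. The schedule $\mathcal S$ consists of bits $\mathcal S_{v,i,j}\in\{0,1\}$ for each station $v$, each phase $i=1,\dots,\lceil cN^2/\ln N\rceil$, and each $j=1,\dots,T$. An activated station $v$, until it switches off, transmits in round $(i-1)T+j$ of its local clock if and only if $\mathcal S_{v,i,j}=1$; after the last phase it is silent. *)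

(* Defs.v *)
From mathcomp Require Import all_boot all_order all_algebra.
From mathcomp Require Import reals exp.

Set Implicit Arguments.
Unset Strict Implicit.
Unset Printing Implicit Defensive.

Import Order.TTheory GRing.Theory Num.Theory.

Local Open Scope ring_scope.

Definition phase_length (R : realType) (N : nat) : nat :=
  `|Num.ceil (ln (N%:R : R))|%N.

Definition num_phases (R : realType) (c : R) (N : nat) : nat :=
  `|Num.ceil (c * N%:R ^+ 2 / ln (N%:R : R))|%N.

Local Open Scope nat_scope.

(* Stations are the elements of 'I_N. Phases and positions in a phase are
   numbered from 0, whereas local rounds are numbered from 1. *)
Definition schedule (N P T : nat) := 'I_N -> 'I_P -> 'I_T -> bool.

Definition scheduled (N P T : nat) (S : schedule N P T) (v : 'I_N) (r : nat)
    : bool :=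
  [exists i : 'I_P, exists j : 'I_T, (r == i * T + j.+1) && S v i j].

(* Transmitters of global round t, where A is the set of activated stations and
   off the set of those that have already switched off. Global rounds are
   numbered from 0; only the values of wake on A matter. *)
Definition transmitters_given (N P T : nat) (S : schedule N P T)
    (A : {set 'I_N}) (wake : 'I_N -> nat) (off : {set 'I_N}) (t : nat)
    : {set 'I_N} :=
  [set v in A | [&& v \notin off, wake v <= t
                  & scheduled S v (t - wake v).+1]].

(* The stations that have switched off before global round t. *)
Fixpoint switched_off (N P T : nat) (S : schedule N P T)
    (A : {set 'I_N}) (wake : 'I_N -> nat) (t : nat) : {set 'I_N} :=
  if t is t'.+1 then
    let off := switched_off S A wake t' in
    off :|: [set v | transmitters_given S A wake off t' == [set v]]
  else set0.

Definition transmitters (N P T : nat) (S : schedule N P T)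
    (A : {set 'I_N}) (wake : 'I_N -> nat) (t : nat) : {set 'I_N} :=
  transmitters_given S A wake (switched_off S A wake t) t.

Definition transmits_successfully (N P T : nat) (S : schedule N P T)
    (A : {set 'I_N}) (wake : 'I_N -> nat) (v : 'I_N) (t : nat) : bool :=
  transmitters S A wake t == [set v].

(* Main.v *)
(* The schedule is random: in phase i every station transmits with probability
   (h + 1) / (64 * 2^h) in each round, where h is the least level whose cutoff
   B * 4^h / (h + 1) exceeds i. Fix J with k <= 2^J, look at the first L =
   cutoff * T rounds of v, and call a round calm when the sum of the
   transmission probabilities of all activated stations is at most (J + 1) / 8.
   A station contributes at most O(T * B * 2^J) over the whole window, so at
   least half of the rounds are calm. Let q be 1/16 of the smallest transmission
   probability of v in the window. The potential [v is still on] * 2^-(number of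
   successes so far) shrinks by a factor 1 - q in expectation in each calm round:
   if the stations still on have total probability at most 1, then v itself
   succeeds with probability at least q; otherwise some station succeeds with
   the much larger probability e^(-(J+1)/4). As there are at most 2^J successes,
   v fails with probability at most 2^(2^J) * exp(-q L / 2), and this beats the
   union bound over the (N * poly(N))^(2^J) possible sets of stations and ages at
   the time at which v wakes up. What happened before that time matters only
   through the set of stations that are still on. *)
Require Import Defs.
From mathcomp Require Import all_boot all_order all_algebra.
From mathcomp Require Import reals sequences exp.
From mathcomp Require Import ring lra zify.
From mathcomp Require boolp.

Set Implicit Arguments.
Unset Strict Implicit.
Unset Printing Implicit Defensive.

Import Order.TTheory GRing.Theory Num.Theory.

Local Open Scope ring_scope.

(** * Independent biased bits *)

Section BernoulliProduct.
Variables (R : realFieldType) (X : finType) (p : X -> R).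
Implicit Types (S : {ffun X -> bool}) (Y : {set X}) (F : {ffun X -> bool} -> R).

Definition weight S : R := \prod_x (if S x then p x else 1 - p x).

Definition expect F : R := \sum_S weight S * F S.

Definition splice Y S S' : {ffun X -> bool} :=
  [ffun x => if x \in Y then S' x else S x].

Lemma eq_expect F G : F =1 G -> expect F = expect G.
Proof. by move=> FG; apply: eq_bigr => S _; rewrite FG. Qed.

Lemma expectD F G : expect (fun S => F S + G S) = expect F + expect G.
Proof. by rewrite -big_split; apply: eq_bigr => S _; rewrite mulrDr. Qed.

Lemma expectZ a F : expect (fun S => a * F S) = a * expect F.
Proof. by rewrite big_distrr; apply: eq_bigr => S _ /=; rewrite mulrCA. Qed.

Lemma expect_sum (K : finType) (P : pred K) (F : K -> {ffun X -> bool} -> R) :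
  expect (fun S => \sum_(k | P k) F k S) = \sum_(k | P k) expect (F k).
Proof.
by rewrite exchange_big; apply: eq_bigr => S _; rewrite big_distrr.
Qed.

Lemma expect_prod (g : X -> bool -> R) :
  expect (fun S => \prod_x g x (S x)) =
  \prod_x (p x * g x true + (1 - p x) * g x false).
Proof.
rewrite [RHS](eq_bigr (fun x =>
  \sum_(b : bool) (if b then p x else 1 - p x) * g x b)); last first.
  by move=> x _; rewrite big_bool.
by rewrite bigA_distr_bigA; apply: eq_bigr => S _; rewrite -big_split.
Qed.

Lemma expect_cst a : expect (fun=> a) = a.
Proof.
have -> : expect (fun=> a) = a * expect (fun=> \prod_(x : X) 1).
  by rewrite -expectZ; apply: eq_bigr => S _; rewrite big1_eq mulr1.
rewrite (expect_prod (fun _ _ => 1)) [X in a * X]big1 ?mulr1 // => x _.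
by rewrite !mulr1 addrC subrK.
Qed.

Lemma spliceK Y S S' : splice Y (splice Y S S') (splice Y S' S) = S.
Proof. by apply/ffunP => x; rewrite !ffunE; case: (x \in Y). Qed.

Lemma weight_splice Y S S' :
  weight (splice Y S S') * weight (splice Y S' S) = weight S * weight S'.
Proof.
rewrite -!big_split; apply: eq_bigr => x _ /=.
by rewrite !ffunE; case: (x \in Y); rewrite // mulrC.
Qed.

(** Draw two independent copies and swap their coordinates in [Y]: an involution that preserves the
    product weight. This plays the part of conditioning on all bits outside [Y]. *)
Lemma expect_splice Y F :
  expect F = expect (fun S => expect (fun S' => F (splice Y S S'))).
Proof.
pose h (z : {ffun X -> bool} * {ffun X -> bool}) :=
  (splice Y z.1 z.2, splice Y z.2 z.1).
have hK : involutive h by case=> S S'; rewrite /h /= !spliceK.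
rewrite -[LHS]mulr1 -(expect_cst 1) {1}/expect big_distrl /=.
under [LHS]eq_bigr => S _ do rewrite /expect big_distrr /=.
under [RHS]eq_bigr => S _ do rewrite /expect big_distrr /=.
rewrite !pair_big /= (reindex_inj (inv_inj hK)) /=; apply: eq_bigr => -[S S'] _.
by rewrite /= mulr1 [RHS]mulrA -(weight_splice Y) mulrAC.
Qed.

Hypothesis p01 : forall x, 0 <= p x <= 1.

Lemma weight_ge0 S : 0 <= weight S.
Proof.
by apply: prodr_ge0 => x _; have /andP[] := p01 x; case: ifP; rewrite ?subr_ge0.
Qed.

Lemma ler_expect F G : (forall S, F S <= G S) -> expect F <= expect G.
Proof.
by move=> FG; apply: ler_sum => S _; apply: ler_wpM2l (FG S); apply: weight_ge0.
Qed.

Lemma expect_lt1_ex F : expect F < 1 -> exists S, F S < 1.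
Proof.
move=> F1; case: (pickP (fun S => F S < 1)) => [S|allF]; first by exists S.
suff : 1 <= expect F by rewrite leNgt F1.
by rewrite -(expect_cst 1); apply: ler_expect => S; rewrite leNgt allF.
Qed.

End BernoulliProduct.

(** * One run of the channel *)

Section Process.
Variables (R : realFieldType) (I Q : finType) (p : I * Q -> R).
Hypothesis p01 : forall x, 0 <= p x <= 1.
Implicit Types (S : {ffun I * Q -> bool}) (A B : {set I}) (l : I -> option Q).
Implicit Types (u v w : I).

Definition bit S w (o : option Q) : bool := if o is Some r then S (w, r) else false.

Definition bit_prob w (o : option Q) : R := if o is Some r then p (w, r) else 0.

Definition senders S l B : {set I} := [set w in B | bit S w (l w)].

Definition sole_prob l B u : R :=
  bit_prob u (l u) * \prod_(w in B | w != u) (1 - bit_prob w (l w)).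

Lemma bit_prob01 w o : 0 <= bit_prob w o <= 1.
Proof. by case: o => [r|] /=; rewrite ?lexx ?ler01. Qed.

(** Distinct stations read distinct coordinates of [S], so their bits are independent; an idle
    station ([None]) has the constant bit [false]. *)
Lemma expect_pattern l B (b : I -> bool) :
  expect p (fun S => [forall w in B, bit S w (l w) == b w]%:R) =
  \prod_(w in B) (if b w then bit_prob w (l w) else 1 - bit_prob w (l w)).
Proof.
(* [K] settles the idle stations, which match only [false]; [g] spreads the remaining constraints
   over single coordinates, the form that [expect_prod] needs. *)
pose K w : R := if (w \in B) && (l w == None) then (~~ b w)%:R else 1.
pose g (x : I * Q) (c : bool) : R :=
  if (x.1 \in B) && (l x.1 == Some x.2) then (c == b x.1)%:R else 1.
have pairE (G : I * Q -> R) : \prod_x G x = \prod_w \prod_r G (w, r).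
  by rewrite pair_bigA; apply: eq_bigr => -[].
have prodD1 (w : I) (F : Q -> R) :
    (forall r, ~~ ((w \in B) && (l w == Some r)) -> F r = 1) ->
    \prod_r F r = if w \in B then (if l w is Some r then F r else 1) else 1.
  move=> F1; case: (boolP (w \in B)) => wB; last first.
    by rewrite big1 // => r _; rewrite F1 // (negPf wB).
  case E: (l w) => [r|].
    rewrite (bigD1 r) //= big1 ?mulr1 // => r' rr'.
    by apply: F1; rewrite E wB /=; apply: contra rr' => /eqP[->].
  by rewrite big1 // => r _; rewrite F1 // E wB.
rewrite (@eq_expect _ _ _ _ (fun S => \prod_w K w * \prod_x g x (S x))); last first.
  move=> S; transitivity
      (\prod_(w : I) (if w \in B then (bit S w (l w) == b w)%:R else 1) : R).
    case: forallP => [h|h].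
      rewrite big1 // => w _; have := h w.
      by case: ifP => //= wB ->.
    have [w hw] : exists w, ~~ ((w \in B) ==> (bit S w (l w) == b w)).
      apply/existsP; rewrite -negb_forall; apply/negP => /forallP; exact: h.
    move: hw; rewrite negb_imply => /andP[wB nb].
    by rewrite (bigD1 w) //= wB (negPf nb) mul0r.
  rewrite pairE -big_split.
  apply: eq_bigr => w _ /=; rewrite (prodD1 w) /K /g /=; last by move=> r /negPf ->.
  case: (w \in B) => /=; last by rewrite mulr1.
  case: (l w) => [r|] /=; first by rewrite eqxx mul1r.
  by rewrite mulr1; case: (b w).
rewrite expectZ expect_prod.
rewrite pairE -big_split /=.
rewrite [RHS]big_mkcond /=; apply: eq_bigr => w _.
rewrite (prodD1 w) /K /g /=; last by move=> r /negPf ->; rewrite !mulr1 addrC subrK.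
case: (w \in B) => /=; last by rewrite mulr1.
case: (l w) => [r|] /=.
  by rewrite eqxx mul1r; case: (b w); rewrite ?mulr1 ?mulr0 ?addr0 ?add0r.
by rewrite mulr1 subr0; case: (b w).
Qed.

Lemma expect_sole l B u : u \in B ->
  expect p (fun S => (senders S l B == [set u])%:R) = sole_prob l B u.
Proof.
move=> uB.
rewrite (@eq_expect _ _ _ _
  (fun S => [forall w in B, bit S w (l w) == (w == u)]%:R)); last first.
  move=> S; congr (_%:R); congr (nat_of_bool _); apply/eqP/forallP => [E w|h].
    apply/implyP => wB; apply/eqP.
    by have := congr1 (fun Z : {set I} => w \in Z) E; rewrite !inE wB.
  apply/setP => w; rewrite !inE; have := h w; case: (boolP (w \in B)) => /=.
    by move=> _ /eqP.
  by move=> wB _; apply/esym/negP => /eqP wu; rewrite wu uB in wB.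
rewrite expect_pattern (bigD1 u) //= eqxx; congr (_ * _).
by apply: eq_bigr => w /andP[_ /negPf ->].
Qed.

Variables (A : {set I}) (l : nat -> I -> option Q).

Fixpoint off S n : {set I} :=
  if n is n'.+1 then
    off S n' :|: [set w | senders S (l n') (A :\: off S n') == [set w]]
  else set0.

Lemma senders_sub S l' B : senders S l' B \subset B.
Proof. by apply/subsetP => w; rewrite inE => /andP[]. Qed.

Lemma off_sub S n : off S n \subset A.
Proof.
elim: n => [|n IH] /=; first exact: sub0set.
rewrite subUset IH; apply/subsetP => w; rewrite inE => /eqP E.
have /subsetP/(_ w) := senders_sub S (l n) (A :\: off S n).
by rewrite E inE eqxx inE => /(_ isT)/andP[].
Qed.

Definition potential v (O : {set I}) : R := (v \notin O)%:R / 2 ^+ #|O|.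

(* A success of v kills the potential, a success of another station halves it. *)
Lemma potential_step v S n (B := A :\: off S n) : v \in B ->
  potential v (off S n.+1) =
  potential v (off S n) *
  (1 - ((senders S (l n) B == [set v])%:R
        + 2^-1 * \sum_(u in B | u != v) (senders S (l n) B == [set u])%:R)).
Proof.
move=> vB; have vO : v \notin off S n by move: vB; rewrite inE => /andP[].
case: (pickP (fun u => senders S (l n) B == [set u])) => [u /eqP E|E].
  have uB : u \in B.
    by have /subsetP/(_ u) := senders_sub S (l n) B; rewrite E inE eqxx; apply.
  have -> : off S n.+1 = u |: off S n.
    rewrite /= -/B E setUC; congr (_ :|: _); apply/setP => w; rewrite !inE.
    by apply/eqP/eqP => [/set1_inj|->].
  rewrite {1}/potential cardsU1 !inE negb_or E.
  have uO : u \notin off S n by move: uB; rewrite inE => /andP[].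
  have [<-|uv] := eqVneq u v.
    rewrite eqxx big1 ?mulr0 ?addr0 ?subrr ?mulr0 ?mul0r // => w /andP[_ wu].
    by rewrite (inj_eq set1_inj) eq_sym (negPf wu).
  rewrite (inj_eq set1_inj) (negPf uv) (bigD1 u) /=; last by rewrite uB uv.
  rewrite eqxx big1 ?addr0; last first.
    by move=> w /andP[_ wu]; rewrite (inj_eq set1_inj) eq_sym (negPf wu).
  rewrite vO uO /potential vO add1n exprS invfM /= !mulr1n !mul1r.
  by field; rewrite expf_neq0 ?pnatr_eq0.
have -> : off S n.+1 = off S n.
  rewrite /= -/B; apply/setP => w; rewrite !inE E orbF //.
rewrite E big1 ?mulr0 ?addr0 ?subr0 ?mulr1 // => u _.
by rewrite E.
Qed.

Hypothesis fresh : forall w s s', s != s' -> l s w = l s' w -> l s w = None.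

(** The coordinates read in round [n]. By [fresh] no other round reads them, so resampling them
    leaves the history intact. *)
Definition round_bits n : {set I * Q} := [set x | l n x.1 == Some x.2].

Lemma bit_splice_fresh n S S' w :
  bit (splice (round_bits n) S S') w (l n w) = bit S' w (l n w).
Proof.
by case E: (l n w) => [r|] //=; rewrite ffunE inE /= E eqxx.
Qed.

Lemma bit_splice_old n s S S' w : s != n ->
  bit (splice (round_bits n) S S') w (l s w) = bit S w (l s w).
Proof.
move=> sn; case E: (l s w) => [r|] //=; rewrite ffunE inE /=.
by case: eqP => // E'; have := fresh sn (etrans E (esym E')); rewrite E.
Qed.

Lemma off_splice n m S S' : (m <= n)%N -> off (splice (round_bits n) S S') m = off S m.
Proof.
elim: m => [//|m IH] mn /=; rewrite IH 1?ltnW //.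
congr (_ :|: _); apply/setP => w; rewrite !inE; congr (_ == _).
by apply/setP => u; rewrite !inE bit_splice_old // ltn_eqF.
Qed.

(** Induction on rounds: resample the bits of round [n] while the earlier ones stay fixed. The set
    of stations still on is then a constant, and [potential_step] turns into an expected factor. As
    that set depends on the history, the bound by [q] is demanded for every [B] containing [v]. A
    round that is not calm contributes a factor at most 1. *)
Lemma potential_decay v q (calm : pred nat) n : v \in A ->
  (forall s B, (s < n)%N -> calm s -> B \subset A -> v \in B ->
     q <= sole_prob (l s) B v
          + 2^-1 * \sum_(u in B | u != v) sole_prob (l s) B u) ->
  q <= 1 ->
  expect p (fun S => potential v (off S n)) <= \prod_(s < n | calm s) (1 - q).
Proof.
move=> vA hq q1.
have sole_ge0 s (B : {set I}) u : 0 <= sole_prob (l s) B u.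
  rewrite mulr_ge0 //; first by have /andP[] := bit_prob01 u (l s u).
  apply: prodr_ge0 => w _; rewrite subr_ge0.
  by have /andP[] := bit_prob01 w (l s w).
elim: n hq => [|n IH] hq.
  rewrite big_ord0 -[leRHS](expect_cst p); apply: ler_expect => // S.
  by rewrite /potential /= in_set0 cards0 expr0 divr1.
have {}IH := IH (fun s B sn => hq s B (leqW sn)).
pose c := if calm n then 1 - q else 1.
rewrite big_mkcond big_ord_recr /= -big_mkcond /= -/c.
rewrite (expect_splice p (round_bits n)).
suff step S : expect p (fun S' => potential v (off (splice (round_bits n) S S') n.+1))
    <= c * potential v (off S n).
  apply: (le_trans (ler_expect p01 step)); rewrite expectZ mulrC.
  by apply: ler_wpM2r => //; rewrite /c; case: ifP => _; rewrite ?subr_ge0.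
(* Once [v] is off, both potentials vanish. *)
have [vO|vO] := boolP (v \in off S n).
  rewrite /potential vO mul0r mulr0 -(expect_cst p 0); apply: ler_expect => // S'.
  by rewrite /= off_splice // inE vO mul0r.
have vB : v \in A :\: off S n by rewrite inE vO.
set B := A :\: off S n in vB *.
have sE S' : senders (splice (round_bits n) S S') (l n) B = senders S' (l n) B.
  by apply/setP => w; rewrite !inE bit_splice_fresh.
rewrite (@eq_expect _ _ p _ (fun S' => potential v (off S n) * (1 + -1 *
    ((senders S' (l n) B == [set v])%:R
     + 2^-1 * \sum_(u in B | u != v) (senders S' (l n) B == [set u])%:R))));
  last first.
  move=> S'; rewrite potential_step ?off_splice //.
  by rewrite -/B sE mulN1r.
rewrite expectZ mulrC; apply: ler_wpM2r.
  by rewrite /potential mulr_ge0 // ?invr_ge0 ?exprn_ge0.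
rewrite expectD expect_cst expectZ expectD expectZ expect_sum expect_sole //.
rewrite (eq_bigr (sole_prob (l n) B)); last by move=> u /andP[uB _]; exact: expect_sole.
rewrite mulN1r /c; case: ifP => [cn|_].
  by rewrite lerD2l lerN2 hq //; apply/subsetP => w; rewrite inE => /andP[].
rewrite gerDl oppr_le0; apply: addr_ge0 => //.
by apply: mulr_ge0; [rewrite invr_ge0|apply: sumr_ge0].
Qed.

End Process.

(** * Success probabilities in a round of bounded load *)

Section CalmRound.
Variables (R : realType).

Lemma expR_half_le2 : expR (2^-1 : R) <= 2.
Proof.
have h : 1 - 2^-1 <= expR (- 2^-1 : R) by have := expR_ge1Dx (- 2^-1 : R).
rewrite expRN in h.
rewrite -[leRHS]invrK -lef_pV2 ?posrE ?expR_gt0 ?invr_gt0 ?ltr0n //.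
rewrite ?invrK in h *; by lra.
Qed.

Lemma expR_ge_pow2 n : expR (- (n%:R / 2) : R) >= 2 ^- n.
Proof.
rewrite expRN lef_pV2 ?posrE ?expR_gt0 ?exprn_gt0 // expRM_natl.
by apply: lerXn2r; rewrite ?nnegrE ?expR_ge0 ?expR_half_le2.
Qed.

(** Follows from [1 + 2 * x <= expR (2 * x)] and [(1 - x) * (1 + 2 * x) = 1 + x * (1 - 2 * x) >=
    1]. *)
Lemma expR_le1B (x : R) : 0 <= x <= 2^-1 -> expR (- (2 * x)) <= 1 - x.
Proof.
move=> /andP[x0 x1]; rewrite expRN.
have e := expR_ge1Dx (2 * x).
have h : 1 <= (1 - x) * expR (2 * x).
  apply: le_trans (_ : (1 - x) * (1 + 2 * x) <= _); first by nra.
  by apply: ler_wpM2l => //; lra.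
by rewrite -[leLHS]mul1r ler_pdivrMr ?expR_gt0.
Qed.

Variables (I : finType) (P : I -> R) (B : {set I}) (v : I).
Hypothesis P_bound : forall w, 0 <= P w <= 2^-1.
Hypothesis vB : v \in B.

Let sole u := P u * \prod_(w in B | w != u) (1 - P w).

Let load := \sum_(w in B) P w.

Lemma sole_ge u : P u * expR (- (2 * load)) <= sole u.
Proof.
have /andP[Pu0 _] := P_bound u; apply: ler_wpM2l => //.
rewrite /load mulr_sumr -sumrN expR_sum.
rewrite [leRHS]big_mkcondr /=; apply: ler_prod => w _; rewrite expR_ge0 /=.
have := expR_le1B (P_bound w).
case: ifP => // _ /le_trans; apply.
by have /andP[Pw0 _] := P_bound w; rewrite gerBl.
Qed.

(** Split on the load. If it is at most 1, [v] alone suffices, since [expR (-2) >= 1/16]. If it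
    exceeds 1, the sum of [sole_ge] over [B] shows that some station succeeds with probability at
    least [expR (- (2 * b))]; half of this remains because the other stations count with weight
    1/2. *)
Lemma calm_round a b : load <= b -> a <= P v -> a / 16 <= expR (- (2 * b)) / 2 ->
  a / 16 <= sole v + 2^-1 * \sum_(u in B | u != v) sole u.
Proof.
move=> lb aP ab.
have sole0 u : 0 <= sole u.
  apply: le_trans (sole_ge u); rewrite mulr_ge0 ?expR_ge0 //.
  by have /andP[] := P_bound u.
have rest0 : 0 <= \sum_(u in B | u != v) sole u by apply: sumr_ge0.
have [l1|l1] := lerP load 1.
  have e2 : 16^-1 <= expR (- (2 * load)).
    have -> : 16^-1 = 2 ^- 4 :> R by rewrite -natrX.
    apply: le_trans (expR_ge_pow2 4) _; rewrite ler_expR; lra.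
  have /andP[Pv0 _] := P_bound v.
  have : P v / 16 <= sole v by apply: le_trans (sole_ge v); apply: ler_wpM2l.
  move: rest0; set x := \sum_(_ in _ | _) _; set y := sole v; lra.
apply: (le_trans ab).
have tot : load * expR (- (2 * load)) <= sole v + \sum_(u in B | u != v) sole u.
  rewrite -(bigD1 v) //= {1}/load mulr_suml; apply: ler_sum => u _; exact: sole_ge.
have : expR (- (2 * b)) <= load * expR (- (2 * load)).
  apply: le_trans (_ : 1 * expR (- (2 * load)) <= _); last first.
    by apply: ler_wpM2r; rewrite ?expR_ge0 // ltW.
  by rewrite mul1r ler_expR; lra.
move: rest0 tot (sole0 v); set x := \sum_(_ in _ | _) _; set y := sole v; lra.
Qed.

End CalmRound.

(** * Transmission probabilities *)

Section Levels.
Variables (R : realType) (B : nat).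
Hypothesis B0 : (0 < B)%N.

(* Phases below [cutoff j] serve contention at most [2 ^ j]; [cutoff j] has the order
   of k^2 / ln k for k = 2 ^ j. *)
Definition cutoff j := ((B * 4 ^ j) %/ j.+1).+1.

Lemma leq_cutoff i j : (i <= j)%N -> (cutoff i <= cutoff j)%N.
Proof.
move: i j; apply: (homo_leq leqnn (fun y x z => @leq_trans y x z)) => n.
rewrite ltnS leq_divRL // expnS.
apply: leq_trans (_ : (B * 4 ^ n) %/ n.+1 * n.+1 * 4 <= _)%N.
  by rewrite -mulnA leq_mul2l; apply/orP; right; clear B0; lia.
by have := leq_trunc_div (B * 4 ^ n) n.+1; clear B0; lia.
Qed.

Lemma cutoff_unbounded i : exists j, (i < cutoff j)%N.
Proof.
exists i; rewrite ltnS leq_divRL //.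
have h : (i < 2 ^ i)%N by exact: ltn_expl.
have -> : (4 = 2 * 2)%N by [].
by rewrite expnMn; nia.
Qed.

Definition level i := ex_minn (cutoff_unbounded i).

Lemma level_le i j : (i < cutoff j)%N -> (level i <= j)%N.
Proof. by rewrite /level; case: ex_minnP => m _ h /h. Qed.

Lemma lt_cutoff_level i : (i < cutoff (level i))%N.
Proof. by rewrite /level; case: ex_minnP. Qed.

Lemma leq_level i j : (i <= j)%N -> (level i <= level j)%N.
Proof. by move=> ij; apply: level_le; apply: leq_ltn_trans ij (lt_cutoff_level j). Qed.

Definition rate j : R := j.+1%:R / (64 * 2 ^+ j).

Lemma rate_gt0 j : 0 < rate j.
Proof. by rewrite divr_gt0 ?mulr_gt0 ?exprn_gt0 ?ltr0n. Qed.

Lemma rate_anti i j : (i <= j)%N -> rate j <= rate i.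
Proof.
move: i j; apply: (@homo_leq _ rate (fun x y => y <= x)) => [x|y x z h1 h2|n].
- exact: lexx.
- exact: le_trans h2 h1.
rewrite /rate exprS ler_pdivrMr ?mulr_gt0 ?exprn_gt0 ?ltr0n //.
rewrite mulrAC ler_pdivlMr ?mulr_gt0 ?exprn_gt0 ?ltr0n //.
rewrite (mulrCA 64) (mulrCA _ 2) mulrA ler_pM2r ?mulr_gt0 ?exprn_gt0 ?ltr0n //.
by rewrite -[2]/(2%:R) -natrM ler_nat; clear B B0; lia.
Qed.

Definition phase_prob i : R := rate (level i).

Lemma phase_prob_anti i j : (i <= j)%N -> phase_prob j <= phase_prob i.
Proof. by move=> /leq_level; apply: rate_anti. Qed.

Lemma phase_prob_bound i : 0 <= phase_prob i <= 2^-1.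
Proof.
rewrite ltW ?rate_gt0 //=; apply: (le_trans (rate_anti (leq0n _))).
by rewrite /rate expr0 mulr1; lra.
Qed.

Lemma rate_le_phase_prob i j : (i < cutoff j)%N -> rate j <= phase_prob i.
Proof. by move=> /level_le; apply: rate_anti. Qed.

Lemma cutoff_ge j : B%:R * 4 ^+ j / j.+1%:R <= (cutoff j)%:R :> R.
Proof.
rewrite ler_pdivrMr ?ltr0n // -!natrX -!natrM ler_nat /cutoff.
by rewrite ltnW // ltn_ceil.
Qed.

Lemma cutoff_le j : (cutoff j)%:R <= B%:R * 4 ^+ j / j.+1%:R + 1 :> R.
Proof.
rewrite /cutoff -[in leLHS]addn1 natrD lerD2r ler_pdivlMr ?ltr0n //.
by rewrite -!natrX -!natrM ler_nat leq_trunc_div.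
Qed.

(** Group the phases by level. At most [cutoff h] phases have level [h], and [rate h * cutoff h] is
    at most [B * 2 ^ h / 32], as the factors [h + 1] cancel. The geometric sum over [h] costs
    another factor 2. *)
Lemma sum_phase_prob j :
  \sum_(i < cutoff j) phase_prob i <= B%:R * 2 ^+ j / 16.
Proof.
have E (i : 'I_(cutoff j)) :
    phase_prob i = \sum_(h < j.+1) (if level i == h then rate h else 0).
  have ij : (level i < j.+1)%N by rewrite ltnS level_le.
  rewrite (bigD1 (Ordinal ij)) //= eqxx big1 ?addr0 // => h hn.
  by case: eqP => // hE; rewrite -val_eqE /= -hE eqxx in hn.
under eq_bigr => i _ do rewrite E.
rewrite exchange_big /=.
apply: le_trans (_ : \sum_(h < j.+1) B%:R * 2 ^+ h / 32 <= _).
  apply: ler_sum => h _; rewrite -big_mkcond /= sumr_const.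
  have c : (#|[pred i : 'I_(cutoff j) | level i == h]| <= cutoff h)%N.
    rewrite -[leqRHS]card_ord.
    pose f (i : 'I_(cutoff j)) : 'I_(cutoff h) := inord i.
    have lt (i : 'I_(cutoff j)) : level i == h -> (i < cutoff h)%N.
      by move=> /eqP <-; exact: lt_cutoff_level.
    rewrite -(card_in_imset (f := f)) ?max_card // => i i' /lt hi /lt hi' /(congr1 val).
    by rewrite /f /= !inordK // => /val_inj.
  rewrite -[leLHS]mulr_natr; apply: le_trans (_ : rate h * (cutoff h)%:R <= _).
    by apply: (ler_wpM2l (ltW (rate_gt0 h))); rewrite ler_nat.
  (* The successor in [cutoff] is absorbed by doubling, because [h + 1 <= 4 ^ h] and [B] is
     positive. *)
  have c2 : (cutoff h)%:R <= 2 * (B%:R * 4 ^+ h / h.+1%:R) :> R.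
    apply: le_trans (cutoff_le h) _.
    rewrite [leRHS]mulr_natl mulr2n lerD2l ler_pdivlMr ?ltr0n // mul1r.
    rewrite -!natrX -!natrM ler_nat.
    by have := ltn_expl h (isT : (1 < 4)%N); nia.
  apply: le_trans (ler_wpM2l (ltW (rate_gt0 h)) c2) _.
  have e4 : 4 = 2 * 2 :> R by rewrite -natrM.
  rewrite /rate e4 exprMn.
  have : 2 ^+ h != 0 :> R by rewrite expf_neq0 ?pnatr_eq0.
  have : h.+1%:R != 0 :> R by rewrite pnatr_eq0.
  move: (2 ^+ h) (h.+1%:R) => x y y0 x0.
  by rewrite le_eqVlt; apply/orP; left; apply/eqP; field; rewrite y0 x0.
rewrite -mulr_suml -mulr_sumr.
have s : \sum_(h < j.+1) 2 ^+ h <= 2 * 2 ^+ j :> R.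
  elim: j {E} => [|n IH]; first by rewrite big_ord1 expr0; lra.
  rewrite big_ord_recr /= exprS; move: IH; set x := 2 ^+ n.
  by set z := \sum_(_ < _) _; lra.
have : B%:R * \sum_(h < j.+1) 2 ^+ h <= B%:R * (2 * 2 ^+ j) :> R.
  by apply: ler_wpM2l.
by set x := B%:R * _; set y := 2 ^+ j; lra.
Qed.

End Levels.

(** * Local rounds as pairs of a phase and a position *)

Section Slots.
Variables (P T : nat).

(** The pair is unique by division with remainder. The value is [None] for the fictitious round 0
    and after the last phase, so one function covers stations that sleep, run or have finished. *)
Definition slot r : option ('I_P * 'I_T) :=
  [pick x : 'I_P * 'I_T | r == (x.1 * T + x.2.+1)%N].

Lemma slotP r x : slot r = Some x -> r = (x.1 * T + x.2.+1)%N.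
Proof. by rewrite /slot; case: pickP => // y /eqP -> [<-]. Qed.

Lemma slot_pos r (i : 'I_P) (j : 'I_T) :
  r = (i * T + j.+1)%N -> slot r = Some (i, j).
Proof.
move=> rE; rewrite /slot; case: pickP => [[i' j'] /= /eqP|/(_ (i, j))]; last first.
  by rewrite /= rE eqxx.
rewrite rE !addnS => -[E].
have T0 : (0 < T)%N by apply: leq_ltn_trans (ltn_ord j).
have ii' : i = i'.
  apply: val_inj => /=; have := congr1 (divn^~ T) E.
  by rewrite !divnMDl // !divn_small ?ltn_ord // !addn0.
congr Some; congr pair => //; apply: val_inj => /=.
by move: E; rewrite ii' => /addnI.
Qed.

Lemma scheduledE N (S : schedule N P T) v r :
  scheduled S v r = if slot r is Some x then S v x.1 x.2 else false.
Proof.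
apply/existsP/idP => [[i /existsP[j /andP[/eqP rE Sv]]]|].
  by rewrite (slot_pos rE).
case E: (slot r) => [[i j]|] //= Sv; exists i; apply/existsP; exists j.
by rewrite (slotP E) eqxx.
Qed.

Lemma slot0 : slot 0 = None.
Proof. by case E: (slot 0) => [x|] //; have := slotP E; rewrite addnS. Qed.

Lemma slot_over r : (P * T < r)%N -> slot r = None.
Proof.
case E: (slot r) => [[i j]|] // h; have := slotP E; rewrite /= => rE.
have := ltn_ord i; have := ltn_ord j; nia.
Qed.

Lemma slot_in r : (r < P * T)%N ->
  exists x, slot r.+1 = Some x /\ x.1 = (r %/ T)%N :> nat.
Proof.
move=> rPT; have T0 : (0 < T)%N by case: (T) rPT; rewrite ?muln0.
have iP : (r %/ T < P)%N by rewrite ltn_divLR.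
have jT : (r %% T < T)%N by rewrite ltn_mod.
exists (Ordinal iP, Ordinal jT); split => //.
by apply: slot_pos; rewrite /= addnS -divn_eq.
Qed.

Lemma slot_phase r x : slot r = Some x -> x.1 = (r.-1 %/ T)%N :> nat.
Proof.
move=> /slotP ->; rewrite addnS /= divnMDl ?divn_small ?addn0 //.
exact: leq_ltn_trans (ltn_ord x.2).
Qed.

End Slots.

(* Ages at successive rounds form a window of consecutive integers, so for
   nonincreasing q the window starting at age 0 has the largest sum. *)
Lemma sum_window_le (R : realFieldType) (q : nat -> R) (g : nat -> R) L a :
  (forall i, 0 <= q i) -> (forall i j, (i <= j)%N -> q j <= q i) ->
  g 0%N = 0 -> (forall r, g r.+1 <= q r) ->
  \sum_(s < L) g (s + 1 + a - L)%N <= \sum_(s < L) q s.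
Proof.
move=> q0 qd g0 gq.
have [La|aL] := leqP L a.
  apply: ler_sum => s _.
  have -> : (s + 1 + a - L = (s + (a - L)).+1)%N by lia.
  by apply: le_trans (gq _) _; apply: qd; lia.
rewrite -(big_mkord xpredT (fun s => g (s + 1 + a - L)%N)) /=.
rewrite -(big_mkord xpredT q) /=.
rewrite (big_cat_nat (leq0n (L - a)) (leq_subr a L)) /= big_nat_cond.
rewrite big1 ?add0r; last first.
  move=> s /andP[/andP[_ sl] _]; have -> : (s + 1 + a - L = 0)%N by lia.
  exact: g0.
rewrite -{1}[(L - a)%N]add0n big_addn subKn; last exact: ltnW.
rewrite [leRHS](big_cat_nat (leq0n a) (ltnW aL)) /= -[leLHS]addr0 lerD //.
  rewrite !big_mkord; apply: ler_sum => s _.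
  by have -> : (s + (L - a) + 1 + a - L = s.+1)%N by lia.
by apply: sumr_ge0.
Qed.

Lemma sum_phases (R : realFieldType) (q : nat -> R) m T :
  \sum_(s < m * T) q (s %/ T)%N = T%:R * \sum_(i < m) q i.
Proof.
case: T => [|T]; first by rewrite muln0 big_ord0 mul0r.
elim: m => [|m IH]; first by rewrite mul0n !big_ord0 mulr0.
rewrite mulSnr big_split_ord /= IH [in RHS]big_ord_recr /= mulrDr; congr (_ + _).
rewrite (eq_bigr (fun=> q m)); first by rewrite sumr_const card_ord mulr_natl.
by move=> s _; rewrite divnMDl // divn_small ?addn0.
Qed.

(** * Failure probability in a window starting when [v] wakes up *)

Section Window.
Variables (R : realType) (N P T B : nat).
Hypothesis B0 : (0 < B)%N.

Definition bit_rate (x : 'I_N * ('I_P * 'I_T)) : R := phase_prob R B0 x.2.1.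

Lemma bit_rate_bound x : 0 <= bit_rate x <= 1.
Proof.
have /andP[-> h] := phase_prob_bound R B0 x.2.1.
by apply: le_trans h _; lra.
Qed.

(* [f w] is [L] plus the age of station [w] at the start of a window of [L]
   rounds; in round [s] of the window its local round is [s + 1 + f w - L],
   and truncated subtraction gives the idle round 0 before [w] wakes up. *)
Definition window_slot (L : nat) (f : 'I_N -> option nat) (s : nat) w
    : option ('I_P * 'I_T) :=
  if f w is Some a then slot P T (s + 1 + a - L)%N else None.

Lemma window_slot_fresh L f w s s' : s != s' ->
  window_slot L f s w = window_slot L f s' w -> window_slot L f s w = None.
Proof.
rewrite /window_slot; case: (f w) => // a ss' E.
case Es: (slot P T (s + 1 + a - L)%N) => [x|] //.
have h := slotP Es; have h' := slotP (etrans (esym E) Es).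
by move/eqP: ss'; case; lia.
Qed.

(** The condition of [calm_round] for the load bound [(J + 1) / 8]. With [n = J + 1] it follows from
    [n / 4 <= expR (n / 4)] and [expR (n / 2) <= 2 ^ n]. *)
Lemma rate_le_exp J : rate R J / 16 <= expR (- (2 * (J.+1%:R / 8))) / 2.
Proof.
set n := J.+1%:R : R.
have e0 : 0 < expR (n / 4) by exact: expR_gt0.
have e1 : n / 4 <= expR (n / 4).
  by apply: le_trans (expR_ge1Dx _); rewrite lerDr.
have e2 : expR (n / 4) * expR (n / 4) <= 2 ^+ J.+1.
  rewrite -expRD (_ : n / 4 + n / 4 = n * 2^-1); last by lra.
  rewrite expRM_natl; apply: lerXn2r; rewrite ?nnegrE ?expR_ge0 //.
  exact: expR_half_le2.
have x0 : 0 < 2 ^+ J :> R by rewrite exprn_gt0.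
rewrite (_ : 2 * (n / 8) = n / 4); last by lra.
rewrite expRN /rate -/n -mulrA -invfM ler_pdivrMr ?mulr_gt0 //.
rewrite -mulrA [leRHS]mulrC ler_pdivlMr //.
by move: e2; rewrite exprS; nra.
Qed.

Variables (J : nat) (f : 'I_N -> option nat) (v : 'I_N).
Let L := (cutoff B J * T)%N.
Let A := [set w | f w != None].
Let l := window_slot L f.
Hypothesis T0 : (0 < T)%N.
Hypothesis JP : (cutoff B J <= P)%N.
Hypothesis fv : f v = Some L.
Hypothesis A_small : (#|A| <= 2 ^ J)%N.

Let calm s := \sum_(w in A) bit_prob bit_rate w (l s w) <= J.+1%:R / 8.

Lemma own_rate s : (s < L)%N -> rate R J <= bit_prob bit_rate v (l s v).
Proof.
move=> sL; rewrite /l /window_slot fv addnK addn1.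
have [x [-> xE]] : exists x, slot P T s.+1 = Some x /\ x.1 = (s %/ T)%N :> nat.
  by apply: slot_in; apply: leq_trans sL _; rewrite leq_mul2r JP orbT.
by apply: rate_le_phase_prob; rewrite /= xE ltn_divLR.
Qed.

(** By monotonicity the worst case is a station that wakes up together with [v]; its sum runs over
    [cutoff B J] whole phases of [T] rounds. *)
Lemma window_load w : w \in A ->
  \sum_(s < L) bit_prob bit_rate w (l s w) <= T%:R * (B%:R * 2 ^+ J / 16).
Proof.
rewrite inE /l /window_slot; case: (f w) => // a _.
apply: le_trans (_ : T%:R * \sum_(i < cutoff B J) phase_prob R B0 i <= _); last first.
  by apply: ler_wpM2l => //; exact: sum_phase_prob.
rewrite -sum_phases.
apply: (@sum_window_le _ (fun r => phase_prob R B0 (r %/ T))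
  (fun r => bit_prob bit_rate w (slot P T r))).
- by move=> i; have /andP[] := phase_prob_bound R B0 (i %/ T).
- by move=> i j ij; apply: phase_prob_anti; apply: leq_div2r.
- by rewrite slot0.
- move=> r; case E: (slot P T r.+1) => [x|] /=; last first.
    by have /andP[] := phase_prob_bound R B0 (r %/ T).
  by rewrite /bit_rate /= (slot_phase E).
Qed.

(** Markov's inequality: the total load of the window is at most [T * B * 4 ^ J / 16], hence at most
    [(J + 1) * L / 16], while each round that is not calm uses more than [(J + 1) / 8] of it. *)
Lemma calm_count : L%:R / 2 <= #|[pred s : 'I_L | calm s]|%:R :> R.
Proof.
set c := #|_|.
have cD : (c + #|[pred s : 'I_L | ~~ calm s]| = L)%N.
  by have := cardC [pred s : 'I_L | calm s]; rewrite card_ord.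
set d := #|[pred s : 'I_L | ~~ calm s]| in cD.
have h1 : d%:R * (J.+1%:R / 8) <=
    \sum_(s < L) \sum_(w in A) bit_prob bit_rate w (l s w).
  rewrite mulr_natl -sumr_const big_mkcond /=; apply: ler_sum => s _.
  have h0 : 0 <= \sum_(w in A) bit_prob bit_rate w (l s w).
    by apply: sumr_ge0 => w _; have /andP[] := bit_prob01 bit_rate_bound w (l s w).
  by rewrite inE; case: ifP => // nc; rewrite ltW // ltNge.
have h2 : \sum_(s < L) \sum_(w in A) bit_prob bit_rate w (l s w) <=
    2 ^+ J * (T%:R * (B%:R * 2 ^+ J / 16)).
  rewrite exchange_big /=.
  apply: le_trans (_ : \sum_(w in A) T%:R * (B%:R * 2 ^+ J / 16) <= _).
    by apply: ler_sum => w; exact: window_load.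
  rewrite sumr_const -[leLHS]mulr_natl; apply: ler_wpM2r.
    by rewrite !mulr_ge0 ?invr_ge0 ?exprn_ge0.
  by rewrite -natrX ler_nat.
have h3 : T%:R * (B%:R * 4 ^+ J) <= J.+1%:R * L%:R :> R.
  have := cutoff_ge R B J; rewrite ler_pdivrMr ?ltr0n // => h.
  rewrite /L natrM [leRHS]mulrA [leRHS]mulrC; apply: ler_wpM2l => //.
  by rewrite [leRHS]mulrC.
have e4 : 4 ^+ J = 2 ^+ J * 2 ^+ J :> R by rewrite -exprMn -natrM.
have h4 : d%:R * J.+1%:R * 2 <= J.+1%:R * L%:R :> R.
  have := le_trans h1 h2; move: h3; rewrite e4; set x := 2 ^+ J.
  by nra.
have h5 : d%:R * 2 <= L%:R :> R.
  by rewrite -(ler_pM2l (ltr0Sn R J)); move: h4; lra.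
have : (c%:R + d%:R = L%:R :> R) by rewrite -natrD cD.
by move: h5; lra.
Qed.

Lemma window_failure :
  expect bit_rate (fun S => (v \notin off A l S L)%:R) <=
  2 ^+ (2 ^ J) * expR (- (B%:R * T%:R * 2 ^+ J / 2048)).
Proof.
set q := rate R J / 16.
have q0 : 0 <= q by rewrite divr_ge0 // ltW ?rate_gt0.
have q1 : q <= 1.
  have := rate_anti R (leq0n J); rewrite /q /(rate R 0) expr0 mulr1; lra.
have vA : v \in A by rewrite inE fv.
(* At most [2 ^ J] stations can be off, so if [v] is still on its potential is at least
   [2 ^- (2 ^ J)]. *)
apply: le_trans (_ : expect bit_rate
    (fun S => 2 ^+ (2 ^ J) * potential R v (off A l S L)) <= _).
  apply: (ler_expect bit_rate_bound) => S; rewrite /potential mulrCA.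
  apply: ler_peMr => //; rewrite ler_pdivlMr ?exprn_gt0 // mul1r.
  rewrite ler_eXn2l ?ltr1n //; apply: leq_trans A_small.
  exact: subset_leq_card (off_sub A l S L).
rewrite expectZ; apply: ler_wpM2l; first by rewrite exprn_ge0.
apply: le_trans (_ : \prod_(s < L | calm s) (1 - q) <= _).
  apply: (potential_decay bit_rate_bound (@window_slot_fresh L f)) => //.
  move=> s B' sL cs B'A vB'.
  apply: (calm_round (P := fun w => bit_prob bit_rate w (l s w))
            (b := J.+1%:R / 8) _ vB').
  - move=> w; case: (l s w) => [x|] /=; last by rewrite lexx invr_ge0 /=.
    exact: phase_prob_bound.
  - apply: le_trans cs; rewrite [leRHS](big_setID B') /= (setIidPr B'A) lerDl.
    by apply: sumr_ge0 => w _; have /andP[] := bit_prob01 bit_rate_bound w (l s w).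
  - exact: own_rate.
  - exact: rate_le_exp.
rewrite prodr_const; set c := #|_|.
apply: le_trans (_ : expR (- q) ^+ c <= _).
  by apply: lerXn2r; rewrite ?nnegrE ?subr_ge0 ?expR_ge0 // expR_ge1Dx.
rewrite -expRM_natl ler_expR mulrN lerN2.
apply: le_trans (_ : L%:R / 2 * q <= _); last first.
  by apply: ler_wpM2r => //; exact: calm_count.
have h := cutoff_ge R B J.
have e4 : 4 ^+ J = 2 ^+ J * 2 ^+ J :> R by rewrite -exprMn -natrM.
(* The exponent is [q * L / 2] with [q = (J + 1) / (1024 * 2 ^ J)] and
   [L >= B * T * 4 ^ J / (J + 1)], whence the 2048. *)
apply: le_trans (_ : B%:R * 4 ^+ J / J.+1%:R * T%:R / 2 * q <= _); last first.
  by apply: ler_wpM2r => //; rewrite ler_pM2r ?invr_gt0 // natrM ler_wpM2r.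
rewrite e4 /q /rate.
have : 2 ^+ J != 0 :> R by rewrite expf_neq0 ?pnatr_eq0.
have : J.+1%:R != 0 :> R by rewrite pnatr_eq0.
move: (2 ^+ J) (J.+1%:R) => x y y0 x0.
by rewrite le_eqVlt; apply/orP; left; apply/eqP; field; rewrite y0 x0.
Qed.

End Window.

(** * Reduction of the actual execution to a window *)

Section Restart.
Variables (N P T : nat) (F : {ffun 'I_N * ('I_P * 'I_T) -> bool}).
Variables (A : {set 'I_N}) (wake : 'I_N -> nat) (v : 'I_N).
Let S : schedule N P T := fun w i j => F (w, (i, j)).
Let t0 := wake v.
Let A0 := A :\: switched_off S A wake t0.

(* Stations asleep throughout the window get offset 0, and ages beyond the end
   of the schedule are truncated: this leaves finitely many offsets. *)
Definition offset L w : nat := minn (L + P * T) (L + t0 - wake w).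

Definition window_config L w : option nat :=
  if w \in A0 then Some (offset L w) else None.

(** Before [w] wakes up, truncated subtraction yields round 0. If the age was cut at [L + P * T],
    the true and the cut local round both lie beyond the schedule. *)
Lemma window_slotE L s w : (s < L)%N -> w \in A0 ->
  window_slot P T L (window_config L) s w =
  if (wake w <= t0 + s)%N then slot P T (t0 + s - wake w).+1 else None.
Proof.
move=> sL wA; rewrite /window_slot /window_config wA /offset.
case: ifP => ws; last first.
  rewrite (_ : (s + 1 + _ - L)%N = 0%N) ?slot0 //.
  by move: ws; lia.
have [le|gt] := leqP (L + t0 - wake w) (L + P * T).
  by congr slot; lia.
by rewrite !slot_over //; lia.
Qed.

(** From the waking of [v] on, the execution is a fresh run on [A0]: the past enters only through
    [A0] and the ages of its stations. *)
Lemma switched_off_window L s : (s <= L)%N ->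
  switched_off S A wake (t0 + s) =
  switched_off S A wake t0
    :|: off A0 (window_slot P T L (window_config L)) F s.
Proof.
elim: s => [|s IH] sL; first by rewrite addn0 setU0.
rewrite addnS /= IH 1?ltnW // -setUA; congr (_ :|: (_ :|: _)).
apply/setP => w; rewrite !inE; congr (_ == _).
apply/setP => u; rewrite !inE negb_or.
have [uA|] := boolP (u \in A); last by rewrite !andbF.
have [uo|uo] := boolP (u \in switched_off S A wake t0) => /=.
  by rewrite andbF.
rewrite window_slotE ?inE ?uo //; case: ifP => //= _; last by rewrite !andbF.
by rewrite scheduledE andbT; case: (slot _ _ _) => [[]|].
Qed.

Lemma awake_switched_off t : v \in switched_off S A wake t ->
  exists t', [/\ (wake v <= t')%N, (t' < t)%N & transmits_successfully S A wake v t'].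
Proof.
elim: t => [|t IH] /=; first by rewrite inE.
rewrite inE => /orP[/IH [t' [h1 h2 h3]]|].
  by exists t'; split => //; exact: ltnW.
rewrite inE => h; exists t; split => //.
by move/eqP/setP/(_ v): h; rewrite !inE eqxx => /and3P[_ _ /andP[]].
Qed.

Lemma window_config_self L : v \in A -> window_config L v = Some L.
Proof.
move=> vA; have v0 : v \notin switched_off S A wake t0.
  apply/negP => /awake_switched_off[t [h1 h2 _]].
  by move: h2; rewrite ltnNge h1.
by rewrite /window_config inE v0 vA /offset addnK; congr Some; lia.
Qed.

Lemma window_config_supp L : [set w | window_config L w != None] = A0.
Proof. by apply/setP => w; rewrite inE /window_config; case: ifP. Qed.

Lemma window_success L :
  v \in off A0 (window_slot P T L (window_config L)) F L ->
  exists t, [/\ (wake v <= t)%N, (t - wake v < L)%N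
              & transmits_successfully S A wake v t].
Proof.
move=> vL; have : v \in switched_off S A wake (t0 + L).
  by rewrite (switched_off_window (leqnn L)) inE vL orbT.
by case/awake_switched_off => t [h1 h2 h3]; exists t; split => //; lia.
Qed.

End Restart.

(** * Counting partial assignments of small support *)

Section ConfigCount.
Variables (R : realType) (N M n : nat).
Hypothesis N0 : (0 < N)%N.
Hypothesis M0 : (0 < M)%N.
Implicit Types f : {ffun 'I_N -> option 'I_M}.

(** Generating function at [x = 1 / (N * M)]: each counted [f] has weight at least [x ^ n], while
    the weights of all functions sum to [(1 + M * x) ^ N = (1 + 1 / N) ^ N], which is at most
    [expR 1 <= 4]. *)
Lemma card_configs :
  #|[set f : {ffun 'I_N -> option 'I_M} | (#|[set w | f w != None]| <= n)%N]|%:R <=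
  4 * (N * M)%:R ^+ n :> R.
Proof.
set C := [set _ | _].
have X0 : 0 < (N * M)%:R :> R by rewrite ltr0n muln_gt0 N0.
set x := (N * M)%:R^-1 : R.
have x0 : 0 < x by rewrite invr_gt0.
have x1 : x <= 1 by rewrite invf_le1 // ler1n muln_gt0 N0.
rewrite -ler_pdivrMr ?exprn_gt0 // -exprVn -/x mulr_natl -sumr_const.
apply: le_trans (_ : \sum_(f : {ffun 'I_N -> option 'I_M}) \prod_w
    (if f w is Some _ then x else 1) <= _).
  rewrite big_mkcond /=; apply: ler_sum => f _.
  have -> : \prod_w (if f w is Some _ then x else 1)
      = x ^+ #|[set w | f w != None]|.
    rewrite -prodr_const [RHS]big_mkcond /=; apply: eq_bigr => w _.
    by rewrite inE; case: (f w).
  case: ifP => [|_]; last by rewrite exprn_ge0 // ltW.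
  by rewrite inE => fn; apply: ler_wiXn2l => //; exact: ltW.
rewrite -(bigA_distr_bigA (fun (_ : 'I_N) (o : option 'I_M) =>
   if o is Some _ then x else 1)) /=.
have sumE : \sum_(o : option 'I_M) (if o is Some _ then x else 1) <= expR (N%:R^-1).
  apply: le_trans (expR_ge1Dx _).
  rewrite (bigD1 None) //= lerD2l.
  rewrite (eq_bigr (fun=> x)); last by case.
  rewrite sumr_const (_ : #|_| = M); last first.
    have := cardC1 (None : option 'I_M); rewrite card_option card_ord => h.
    by rewrite -[RHS]/(M.+1.-1) -h; apply: eq_card => -[].
  rewrite -[leLHS]mulr_natl /x natrM invfM mulrCA mulfV ?mulr1 //.
  by rewrite pnatr_eq0 -lt0n.
apply: le_trans (_ : \prod_(w < N) expR (N%:R^-1) <= _).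
  apply: ler_prod => w _; rewrite sumE andbT sumr_ge0 // => -[o|] _ //.
  exact: ltW.
rewrite prodr_const card_ord -expRM_natl mulfV ?pnatr_eq0 -?lt0n //.
rewrite -[1](_ : 2^-1 + 2^-1 = 1) ?expRD; last by lra.
have := expR_half_le2 R; have := expR_ge0 (2^-1 : R); nra.
Qed.

End ConfigCount.

(** * Derandomization *)

(** Union bound over [J], [v] and [f]. Since [T >= ln N] and [B >= 10 * 2048], one triple fails with
    probability at most [2 ^ n * N ^ (-10 n)], where [n = 2 ^ J]. There are at most
    [4 * (N * M) ^ n] functions [f], and [2 * N * M <= N ^ 6], so each pair of [J] and [v] costs at
    most [4 / N ^ 4]. *)
Lemma good_bits (R : realType) (N P T B : nat) (B0 : (0 < B)%N)
    (M := (2 * (P * T)).+1) :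
  10 * 2048 <= B%:R :> R -> ln (N%:R : R) <= T%:R -> (0 < T)%N -> (8 <= N)%N ->
  (M <= N ^ 4)%N ->
  exists F : {ffun 'I_N * ('I_P * 'I_T) -> bool},
  forall (J : nat) (v : 'I_N) (f : {ffun 'I_N -> option 'I_M}),
    let A := [set w | f w != None] in
    let L := (cutoff B J * T)%N in
    let g w := omap (@nat_of_ord M) (f w) in
    (J <= N)%N -> (cutoff B J <= P)%N -> g v = Some L -> (#|A| <= 2 ^ J)%N ->
    v \in off A (window_slot P T L g) F L.
Proof.
move=> hB lnT T0 N8 MN.
pose A (f : {ffun 'I_N -> option 'I_M}) := [set w | f w != None].
pose L J := (cutoff B J * T)%N.
pose g (f : {ffun 'I_N -> option 'I_M}) w := omap (@nat_of_ord M) (f w).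
pose cond J v f :=
  [&& (cutoff B J <= P)%N, g f v == Some (L J) & (#|A f| <= 2 ^ J)%N].
(* The indicator is zero when the side conditions fail, so the sums may range over all triples. *)
pose miss J v f (F : {ffun 'I_N * ('I_P * 'I_T) -> bool}) : R :=
  (cond J v f && (v \notin off (A f) (window_slot P T (L J) (g f)) F (L J)))%:R.
have N0 : 0 < N%:R :> R by rewrite ltr0n; apply: leq_trans N8.
pose y := N%:R^-1 : R.
have y0 : 0 < y by rewrite invr_gt0.
have miss_le J v f : expect (@bit_rate R N P T B B0) (miss J v f) <=
    if (#|A f| <= 2 ^ J)%N then 2 ^+ (2 ^ J) * y ^+ (10 * 2 ^ J) else 0.
  rewrite /miss; case C: (cond J v f) => /=; last first.
    rewrite expect_cst; case: ifP => // _.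
    by rewrite mulr_ge0 // exprn_ge0 // ltW.
  case/and3P: C => CP /eqP gv CA; rewrite CA.
  have AE : A f = [set w | g f w != None].
    by apply/setP => w; rewrite !inE /g; case: (f w).
  move: CA; rewrite AE => CA.
  apply: le_trans (window_failure R B0 T0 CP gv CA) _.
  apply: ler_wpM2l; first by rewrite exprn_ge0.
  rewrite /y exprVn -[N%:R](lnK (x := N%:R)) ?posrE // -expRM_natl -expRN.
  rewrite ler_expR lerN2 natrM natrX.
  have x0 : 0 <= 2 ^+ J :> R by rewrite exprn_ge0.
  rewrite ler_pdivlMr //; move: hB; have : 0 < 2048 :> R by [].
  move: (2048 : R) => c c0 hc.
  have h1 : 10 * c * ln N%:R <= B%:R * T%:R.
    apply: le_trans (_ : 10 * c * T%:R <= _); last exact: ler_wpM2r.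
    by apply: ler_wpM2l => //; rewrite mulr_ge0 // ltW.
  have := ler_wpM2r x0 h1.
  by move: (ln _) (2 ^+ J) (B%:R * T%:R) => a b e; lra.
have count J : \sum_f (if (#|A f| <= 2 ^ J)%N
      then 2 ^+ (2 ^ J) * y ^+ (10 * 2 ^ J) else 0) <= 4 * y ^+ 4.
  rewrite -big_mkcond /= sumr_const -[leLHS]mulr_natl.
  have := card_configs R (N := N) (M := M) (2 ^ J)
    (leq_trans (isT : (0 < 8)%N) N8) (ltn0Sn _).
  rewrite cardsE; set c := #|_| => h.
  set n := (2 ^ J)%N in h *; have n0 : (0 < n)%N by rewrite expn_gt0.
  apply: le_trans (_ : 4 * (N * M)%:R ^+ n * (2 ^+ n * y ^+ (10 * n)) <= _).
    by apply: ler_wpM2r => //; rewrite mulr_ge0 // exprn_ge0 // ltW.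
  rewrite -mulrA ler_pM2l // exprM -!exprMn.
  have b1 : (N * M)%:R * (2 * y ^+ 10) <= y ^+ 4.
    have hNM : (N * M)%:R * 2 <= N%:R ^+ 6 :> R.
      rewrite -natrX -natrM ler_nat.
      apply: leq_trans (_ : N * N ^ 4 * N <= _)%N.
        by apply: leq_mul; [rewrite leq_mul2l MN orbT|apply: leq_trans N8].
      by rewrite -expnS -expnSr.
    rewrite mulrA; apply: le_trans (_ : N%:R ^+ 6 * y ^+ 10 <= _).
      by apply: ler_wpM2r => //; apply: exprn_ge0; exact: ltW.
    rewrite (_ : 10 = 6 + 4)%N // exprD mulrA -exprMn mulfV ?gt_eqF //.
    by rewrite expr1n mul1r.
  have y1 : y ^+ 4 <= 1.
    by rewrite exprn_ile1 ?ltW // invf_lt1 // ltr1n; apply: leq_trans N8.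
  apply: le_trans (_ : (y ^+ 4) ^+ n <= _).
    apply: lerXn2r => //; rewrite nnegrE; last by rewrite exprn_ge0 // ltW.
    by apply: mulr_ge0 => //; apply: mulr_ge0 => //; apply/exprn_ge0/ltW.
  rewrite -[leRHS]expr1; apply: ler_wiXn2l => //.
  by apply/exprn_ge0/ltW.
pose total F := \sum_(J < N.+1) \sum_(v < N) \sum_f miss J v f F.
have [F FP] : exists F, total F < 1.
  apply: (expect_lt1_ex (@bit_rate_bound R N P T B B0)).
  rewrite /total expect_sum.
  apply: le_lt_trans (_ : \sum_(J < N.+1) \sum_(v < N) 4 * y ^+ 4 < 1).
    apply: ler_sum => J _; rewrite expect_sum; apply: ler_sum => v _.
    rewrite expect_sum; apply: le_trans (count J); apply: ler_sum => f _.
    exact: miss_le.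
  (* What remains is [4 * N * (N + 1) < N ^ 4]. *)
  rewrite !sumr_const !card_ord -mulrnA -[ltLHS]mulr_natr mulrAC exprVn.
  rewrite ltr_pdivrMr ?exprn_gt0 // mul1r -natrX -natrM ltr_nat !expnS expn0.
  by nia.
exists F => J v f /= JN JP gv Af.
apply: contraTT FP => vO; rewrite -leNgt /total.
have Jlt : (J < N.+1)%N by [].
have miss0 J' v' f' : 0 <= miss J' v' f' F by rewrite ler0n.
rewrite (bigD1 (Ordinal Jlt)) //= (bigD1 v) //= (bigD1 f) //= -!addrA.
rewrite {1}/miss /cond JP /g gv eqxx /L /A Af /= vO lerDl.
rewrite addr_ge0 ?sumr_ge0 // addr_ge0 ?sumr_ge0 // => *; rewrite ?sumr_ge0 // => *.
by rewrite sumr_ge0.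
Qed.

Lemma good_schedule (R : realType) (N P T B : nat) : (0 < B)%N ->
  10 * 2048 <= B%:R :> R -> ln (N%:R : R) <= T%:R -> (0 < T)%N -> (8 <= N)%N ->
  ((2 * (P * T)).+1 <= N ^ 4)%N ->
  exists S : schedule N P T,
  forall (J : nat) (A : {set 'I_N}) (wake : 'I_N -> nat) (v : 'I_N),
    (J <= N)%N -> (cutoff B J <= P)%N -> (#|A| <= 2 ^ J)%N -> v \in A ->
    exists t, [/\ (wake v <= t)%N, transmits_successfully S A wake v t
                & (t - wake v < cutoff B J * T)%N].
Proof.
move=> B0 hB lnT T0 N8 MN; have [F FP] := good_bits B0 hB lnT T0 N8 MN.
exists (fun v i j => F (v, (i, j))) => J A wake v JN JP AJ vA.
set L := (cutoff B J * T)%N.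
have LPT : (L <= P * T)%N by rewrite leq_mul2r JP orbT.
(* The encoding loses nothing: offsets are at most [L + P * T <= 2 * (P * T)]. *)
pose f : {ffun 'I_N -> option 'I_(2 * (P * T)).+1} :=
  [ffun w => omap inord (window_config F A wake v L w)].
have fE w : omap (@nat_of_ord _) (f w) = window_config F A wake v L w.
  rewrite ffunE /window_config; case: ifP => //= _; congr Some.
  by rewrite inordK // ltnS /offset; apply: leq_trans (geq_minl _ _) _; lia.
have suppE : [set w | f w != None] =
    A :\: switched_off (fun v i j => F (v, (i, j))) A wake (wake v).
  rewrite -(window_config_supp F A wake v L); apply/setP => w; rewrite !inE -fE.
  by case: (f w).
have := FP J v f; rewrite suppE -/L => H.
have vL : v \in off (A :\: switched_off (fun v i j => F (v, (i, j))) A wake (wake v))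
    (window_slot P T L (window_config F A wake v L)) F L.
  rewrite (_ : window_slot _ _ _ _ =
      window_slot P T L (fun w => omap (@nat_of_ord _) (f w))).
    apply: H => //; first by rewrite fE window_config_self.
    exact: leq_trans (subset_leq_card (subsetDl _ _)) AJ.
  by apply/boolp.funext => s; apply/boolp.funext => w; rewrite /window_slot fE.
by have [t [h1 h2 h3]] := window_success vL; exists t.
Qed.

Lemma double_lt_pow4 B N Z : (20 * B + 8 <= N)%N ->
  (Z <= 10 * B * N ^ 2 + 2 * N)%N -> ((2 * Z).+1 <= N ^ 4)%N.
Proof.
move=> hN hZ; have N2 : (N <= N ^ 2)%N by rewrite expnS expn1 leq_pmull //; lia.
apply: leq_trans (_ : (20 * B + 8) * N ^ 2 <= _)%N; last first.
  rewrite (expnD N 2 2) leq_mul2r; apply/orP; right; exact: leq_trans hN N2.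
rewrite mulnDl -mulnA; rewrite -mulnA in hZ.
by move: (N ^ 2)%N (B * N ^ 2)%N hZ N2 => X Y; lia.
Qed.

(** * Logarithms and rounding *)

Section Numerics.
Variable R : realType.

Lemma natr_ceil_bounds (x : R) : 0 <= x ->
  x <= `|Num.ceil x|%N%:R <= x + 1.
Proof.
move=> x0; have c0 : 0 <= Num.ceil x by rewrite ceil_ge0 (lt_le_trans _ x0) ?ltrN10.
rewrite natr_absz ger0_norm // ceil_ge /= -lerBlDr.
by have := ceilB1_lt x; rewrite intrB => /ltW.
Qed.

Lemma ln_le_up_log k : (0 < k)%N -> ln (k%:R : R) <= (up_log 2 k).+1%:R.
Proof.
move=> k0; rewrite -ler_expR lnK ?posrE ?ltr0n //.
apply: le_trans (_ : 2 ^+ (up_log 2 k) <= _).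
  by rewrite -natrX ler_nat up_logP.
have e : 2 <= expR (1 : R) by apply: le_trans (expR_ge1Dx _); rewrite -[1 + 1]/(2%:R).
apply: le_trans (_ : expR (1 : R) ^+ (up_log 2 k) <= _).
  by apply: lerXn2r; rewrite ?nnegrE ?expR_ge0.
by rewrite -expRM_natl mulr1 ler_expR ler_nat.
Qed.

Lemma ln_natr_gt0 k : (1 < k)%N -> 0 < ln (k%:R : R).
Proof. by move=> k1; rewrite ln_gt0 // ltr1n. Qed.

(** For [J = up_log 2 k] one has [2 ^ J <= 2 * k] and [J + 1 >= ln k], which gives the factor 4; the
    successor in [cutoff] fits into one further [B * k ^ 2 / ln k] because [ln k < k]. *)
Lemma cutoff_up_log_le B k : (0 < B)%N -> (1 < k)%N ->
  (cutoff B (up_log 2 k))%:R <= 5 * B%:R * k%:R ^+ 2 / ln (k%:R : R).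
Proof.
move=> B0 k1; have l0 := ln_natr_gt0 k1.
have lJ := ln_le_up_log (ltnW k1).
apply: le_trans (cutoff_le _ _ _) _.
have k2 : 2 ^+ up_log 2 k <= 2 * k%:R :> R.
  have /andP[h _] := up_log_bounds (isT : (1 < 2)%N) k1.
  have J0 : (0 < up_log 2 k)%N by rewrite up_log_gt0.
  rewrite -(prednK J0) exprS ler_pM2l // -natrX ler_nat; exact: ltnW.
have k4 : 4 ^+ up_log 2 k <= 4 * k%:R ^+ 2 :> R.
  rewrite (_ : 4 = 2 ^+ 2 :> R); last by rewrite -natrX.
  rewrite exprAC -exprMn; apply: lerXn2r => //.
    by rewrite nnegrE exprn_ge0.
  by rewrite nnegrE mulr_ge0.
have B1 : 1 <= B%:R :> R by rewrite ler1n.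
rewrite [leRHS](_ : _ = B%:R * (4 * k%:R ^+ 2) / ln k%:R
    + B%:R * k%:R ^+ 2 / ln k%:R); last by ring.
apply: lerD.
  apply: ler_pM; rewrite ?mulr_ge0 ?invr_ge0 ?exprn_ge0 //.
    by apply: ler_wpM2l.
  by rewrite lef_pV2 ?posrE.
rewrite ler_pdivlMr // mul1r.
have k0 : 0 < k%:R :> R by rewrite ltr0n ltnW.
have lk := ln_sublinear k0; have k1R : 1 <= k%:R :> R by rewrite ler1n ltnW.
have : k%:R <= B%:R * k%:R ^+ 2 :> R by nra.
exact/le_trans/ltW.
Qed.

Lemma ln_natr_ge1 N : (4 <= N)%N -> 1 <= ln (N%:R : R).
Proof.
move=> N4; rewrite -ler_expR lnK ?posrE ?ltr0n; last exact: leq_trans N4.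
apply: le_trans (_ : 4 <= _); last by rewrite ler_nat.
rewrite (_ : 1 = 2^-1 + 2^-1 :> R) ?expRD; last by lra.
by have := expR_half_le2 R; have := expR_ge0 (2^-1 : R); nra.
Qed.

End Numerics.

Theorem theorem1p4 (R : realType) (d : R) (hd : 0 < d) :
  exists (c C : R) (N0 : nat),
    [/\ 0 < c, 0 < C &
      forall N : nat, (N0 <= N)%N ->
      exists S : schedule N (num_phases c N) (phase_length R N),
      forall k : nat, (1 < k)%N -> (k <= N)%N ->
        ln (ln (N%:R : R)) <= d * ln (k%:R : R) ->
      forall (A : {set 'I_N}) (wake : 'I_N -> nat), (#|A| <= k)%N ->
      forall v : 'I_N, v \in A ->
      exists t : nat,
        [/\ (wake v <= t)%N,
            transmits_successfully S A wake v t
          & ((t - wake v).+1)%:R <= C * k%:R ^+ 2 * ln (N%:R : R) / ln (k%:R : R)]].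
Proof.
have [B [B0 hB]] : exists B : nat, (0 < B)%N /\ 10 * 2048 <= B%:R :> R.
  exists (10 * 2048)%N; split => //.
  by rewrite natrM.
have B1 : 1 <= B%:R :> R by rewrite ler1n.
(* The constant [c] makes the schedule reach the cutoff for [k = N]. [C] is twice as large because
   [T <= 2 * ln N], and the threshold is the one of [double_lt_pow4]. *)
exists (5 * B%:R), (10 * B%:R), (20 * B + 8)%N; split; try lra.
move=> N hN.
have N8 : (8 <= N)%N by lia.
have N1 : (1 < N)%N by lia.
have l1 : 1 <= ln (N%:R : R) by apply: ln_natr_ge1; lia.
set P := num_phases _ _; set T := phase_length _ _.
have /andP[T_ge T_le] : ln (N%:R : R) <= T%:R <= ln (N%:R : R) + 1.
  by apply: natr_ceil_bounds; lra.
have N0R : 0 < N%:R :> R by rewrite ltr0n ltnW.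
have X0 : 0 <= 5 * B%:R * N%:R ^+ 2 / ln (N%:R : R).
  by rewrite !mulr_ge0 ?exprn_ge0 ?invr_ge0 //; lra.
have /andP[P_ge P_le] := natr_ceil_bounds X0.
rewrite -/(num_phases (5 * B%:R) N) -/P in P_ge P_le.
have T0 : (0 < T)%N by rewrite -(ltr_nat R); lra.
have PT : (P * T)%:R <= 10 * B%:R * N%:R ^+ 2 + 2 * N%:R :> R.
  rewrite natrM; apply: le_trans (_ : P%:R * (2 * ln N%:R) <= _).
    by apply: ler_wpM2l => //; lra.
  apply: le_trans (_ : (5 * B%:R * N%:R ^+ 2 / ln N%:R + 1) * (2 * ln N%:R) <= _).
    by apply: ler_wpM2r => //; lra.
  have lN := ln_sublinear N0R.
  rewrite mulrDl mulrCA divfK; last by rewrite gt_eqF //; lra.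
  lra.
have M_le : ((2 * (P * T)).+1 <= N ^ 4)%N.
  apply: double_lt_pow4 hN _; rewrite -(ler_nat R); apply: (le_trans PT).
  by rewrite natrD (natrM _ (10 * B)) natrX !natrM.
have [S SP] := good_schedule B0 hB T_ge T0 N8 M_le.
exists S => k k1 kN _ A wake Ak v vA; pose J := up_log 2 k.
have JN : (J <= up_log 2 N)%N by apply: leq_up_log.
have JP : (cutoff B J <= P)%N.
  apply: leq_trans (leq_cutoff B JN) _; rewrite -(ler_nat R).
  exact: le_trans (cutoff_up_log_le R B0 N1) P_ge.
have [|t [h1 h2 h3]] := SP J A wake v _ JP
    (leq_trans Ak (up_logP k (isT : (1 < 2)%N))) vA.
  by apply: leq_trans JN _; rewrite up_log_min // ltnW // ltn_expl.
exists t; split => //.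
(* The strict bound [h3] absorbs the successor that turns an age into a local round. *)
apply: le_trans (_ : (cutoff B J * T)%:R <= _); first by rewrite ler_nat.
rewrite natrM; apply: le_trans (_ : 5 * B%:R * k%:R ^+ 2 / ln k%:R * (2 * ln N%:R) <= _).
  by apply: ler_pM => //; [exact: cutoff_up_log_le|lra].
rewrite le_eqVlt; apply/orP; left; apply/eqP; field.
by rewrite gt_eqF // ln_natr_gt0.
Qed.
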